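(* Let $\mu\in\mathbb C\setminus\mathbb R$ and $\Lambda_\mu=\mathbb Z+\mathbb Z\mu$. For a finite set $F\subset\mathbb Z^2$ and $z\in\mathbb C\setminus\Lambda_\mu$ put \[\wp^{\sf nc}_F(z)=\sum_{(m,n)\in F}(z-(m\mu+n))^{-2},\qquad (\wp^{\sf nc}_F)'(z)=-2\sum_{(m,n)\in F}(z-(m\mu+n))^{-3},\] \[g_{1,F}=\sum_{(m,n)\in F\setminus\{(0,0)\}}(m\mu+n)^{-2},\quad g_{2,F}=60\sum_{(m,n)\in F\setminus\{(0,0)\}}(m\mu+n)^{-4},\quad g_{3,F}=140\sum_{(m,n)\in F\setminus\{(0,0)\}}(m\mu+n)^{-6},\] and \[E_F(X,Y)=Y^2-4X^3+12g_{1,F}X^2-\big(12g_{1,F}^2-g_{2,F}\big)X+\big(4g_{1,F}^3-g_{1,F}g_{2,F}+g_{3,F}\big).\] Then for every $z\in\mathbb C\setminus\Lambda_\mu$ and every cone ultrafilter $\mathfrak u$ on ${\sf Fin}(\mathbb Z^2)$, the element of ${}^{\circ}\mathbb C_{\mathfrak u}$ represented by the net $F\mapsto E_F\big(\wp^{\sf nc}_F(z),(\wp^{\sf nc}_F)'(z)\big)$ is infinitesimal. (That is, the pair formed by the Weierstrass function without correction terms and its derivative, restricted to cone ultrafilters, solves the infinitesimal Weierstrass equation ${}^{\circ}E_\mu(X,Y)\simeq 0$.)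
   Context: ${\sf Fin}(\mathbb Z^2)$ is the set of finite subsets of $\mathbb Z^2$, directed by inclusion. A cone ultrafilter on ${\sf Fin}(\mathbb Z^2)$ is an ultrafilter containing every set $\{F'\in{\sf Fin}(\mathbb Z^2): F\subset F'\}$, $F\in{\sf Fin}(\mathbb Z^2)$. For an ultrafilter $\mathfrak u$ on ${\sf Fin}(\mathbb Z^2)$, ${}^{\circ}\mathbb C_{\mathfrak u}$ is the ultrapower of $\mathbb C$ indexed by ${\sf Fin}(\mathbb Z^2)$ with respect to $\mathfrak u$ (nets $F\mapsto z_F\in\mathbb C$ modulo agreement on a member of $\mathfrak u$), with its induced (nonstandard) absolute value taking values in the ordered ultrapower of $\mathbb R$; an element is infinitesimal if its absolute value is less than every positive standard real number. *)

(* Defs.v *)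
From HB Require Import structures.
From mathcomp Require Import all_boot all_order all_algebra finmap complex.
From mathcomp Require Import all_classical all_reals.

Set Implicit Arguments.
Unset Strict Implicit.
Unset Printing Implicit Defensive.

Import Order.TTheory GRing.Theory Num.Theory.
Local Open Scope classical_set_scope.
Local Open Scope quotient_scope.
Local Open Scope ring_scope.

Section Ultrapower.
Context {I : Type} (u : set_system I) {uU : UltraFilter u}.

Section Carrier.
Variable K : choiceType.
Implicit Types f g : I -> K.

Definition net_eqb f g : bool := `[< \forall i \near u, f i = g i >].

Lemma net_eqb_refl : reflexive net_eqb.
Proof. by move=> f; apply/asboolP; apply: filterE. Qed.

Lemma net_eqb_sym : symmetric net_eqb.
Proof.
by move=> f g; apply/asboolP/asboolP => H; apply: filterS H => i ->.
Qed.

Lemma net_eqb_trans : transitive net_eqb.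
Proof.
move=> g f h /asboolP fg /asboolP gh; apply/asboolP.
by apply: filterS2 fg gh => i -> ->.
Qed.

Canonical net_equiv := EquivRel net_eqb net_eqb_refl net_eqb_sym net_eqb_trans.

Definition ultrapower := {eq_quot net_equiv}.

Definition net_class f : ultrapower := \pi_ultrapower f.

(* The diagonal embedding of standard elements. *)
Definition ultra_std (x : K) : ultrapower := net_class (fun=> x).

Lemma net_classP f g : net_class f = net_class g <-> \forall i \near u, f i = g i.
Proof.
split=> [/eqmodP /asboolP //|H].
by apply/eqmodP/asboolP.
Qed.

Lemma repr_net_class f : \forall i \near u, repr (net_class f) i = f i.
Proof. by apply/net_classP; rewrite /net_class reprK. Qed.

End Carrier.

(* The operations below go through representatives; the [_class] lemmas show
   that they do not depend on the choice. *)
Definition ultra_map (K L : choiceType) (h : K -> L) (x : ultrapower K) :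
  ultrapower L := net_class (h \o repr x).

Lemma ultra_map_class (K L : choiceType) (h : K -> L) (f : I -> K) :
  ultra_map h (net_class f) = net_class (h \o f).
Proof.
by apply/net_classP; apply: filterS (repr_net_class f) => i /= ->.
Qed.

Definition ultra_lt (R : realType) (x y : ultrapower R) : Prop :=
  \forall i \near u, repr x i < repr y i.

Lemma ultra_lt_class (R : realType) (f g : I -> R) :
  ultra_lt (net_class f) (net_class g) <-> \forall i \near u, f i < g i.
Proof.
split=> H; have Hf := repr_net_class f; have Hg := repr_net_class g.
  by apply: filterS3 H Hf Hg => i Hi fi gi; rewrite -fi -gi.
by apply: filterS3 H Hf Hg => i Hi fi gi; rewrite fi gi.
Qed.

Definition ultra_abs (R : realType) : ultrapower R[i] -> ultrapower R :=
  ultra_map (@ComplexField.Normc.normc R).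

Definition infinitesimal (R : realType) (x : ultrapower R[i]) : Prop :=
  forall r : R, 0 < r -> ultra_lt (ultra_abs x) (ultra_std r).

End Ultrapower.

Arguments ultrapower {I} u {uU} K.
Arguments net_class {I} u {uU} {K} f.
Arguments ultra_std {I} u {uU} {K} x.

Class ConeUltraFilter (u : set_system {fset int * int}) := {
  #[global] cone_ultra :: UltraFilter u ;
  cone_mem : forall F : {fset int * int}, u [set F' | (F `<=` F')%fset]
}.

Section Weierstrass.
Variables (R : realType) (mu : R[i]).
Implicit Types (F : {fset int * int}) (z X Y : R[i]).

Definition lattice : set R[i] :=
  [set z | exists m n : int, z = m%:~R + n%:~R * mu].

Definition lattice_pt (p : int * int) : R[i] := p.1%:~R * mu + p.2%:~R.

Definition wp_nc F z : R[i] := \sum_(p <- F) (z - lattice_pt p) ^- 2.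

Definition wp_nc' F z : R[i] := - 2 * \sum_(p <- F) (z - lattice_pt p) ^- 3.

Definition g1 F : R[i] := \sum_(p <- (F `\ (0%R, 0%R))%fset) lattice_pt p ^- 2.

Definition g2 F : R[i] :=
  60 * \sum_(p <- (F `\ (0%R, 0%R))%fset) lattice_pt p ^- 4.

Definition g3 F : R[i] :=
  140 * \sum_(p <- (F `\ (0%R, 0%R))%fset) lattice_pt p ^- 6.

Definition weierstrassE F X Y : R[i] :=
  Y ^+ 2 - 4 * X ^+ 3 + 12 * g1 F * X ^+ 2
  - (12 * g1 F ^+ 2 - g2 F) * X + (4 * g1 F ^+ 3 - g1 F * g2 F + g3 F).

End Weierstrass.

(* Main.v *)
Require Import Defs.
From mathcomp Require Import all_boot all_order all_algebra finmap complex.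
From mathcomp Require Import all_classical all_reals.
From mathcomp Require Import ring lra zify.

Set Implicit Arguments.
Unset Strict Implicit.
Unset Printing Implicit Defensive.

Import Order.TTheory GRing.Theory Num.Theory.
Local Open Scope ring_scope.

(** Since the conditionally convergent sum [g1] only translates [X], with
    [x = X - g1] the polynomial [E_F] becomes
    [4 (P3^2 - x^3 + 15 G4 x + 35 G6)], where [Y = -2 P3], and [x], [P3] and the
    Eisenstein sums [G4], [G6] are now unconditionally summable over the
    lattice.  Hence it is enough to treat the square boxes of [Z^2].

    On a box the differential equation is obtained by Eisenstein's method:
    the partial fractions of [p^-2 q^-2] and of [p^-3 q^-3 - p^-4 q^-2] in terms
    of [p - q] are summed over all pairs of box points.  What remains besides
    the Weierstrass polynomial is a combination of the sums
    [S k i = \sum_j (v j - v i)^-k].  The same partial fractions at [z = 0]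
    evaluate the constants, so that [S k i] appears only through the
    discrepancies [S k i - \sum_j (v j)^-k], weighted by coefficients that are
    O(|i|^-3).  A discrepancy involves only the difference of the box and its
    translate by [i], so it is O(|i| / (n - |i|)), and the total error is at
    most a multiple of [\sum_j 1 / ((j + 1) (n - j + 1)) -> 0]. *)

(** The convention [0^-1 = 0] is used on purpose: lattice sums run over sets
    containing [0], whose term vanishes.  The price is the indicator terms in
    the partial fractions, which produce the constants [5 G4] and [35 G6]. *)

Section PartialFractions.
Variable K : fieldType.
Implicit Types (p q : K) (s : seq K).

(** For fixed [d = p - q] this is the expansion in [p] at the double poles [0] and [d]. At [p = 0]
    the convention leaves [(1 + 2) * q ^- 4] on the right, which the indicator removes; likewise at
    [q = 0]. *)
Lemma partial_fraction22 p q :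
  p ^- 2 * q ^- 2 =
    (p ^- 2 * (p - q) ^- 2 + 2 * (p ^- 1 * (p - q) ^- 3))
    + (q ^- 2 * (q - p) ^- 2 + 2 * (q ^- 1 * (q - p) ^- 3))
    + p ^- 4 *+ (p == q) - (3 * q ^- 4) *+ (p == 0) - (3 * p ^- 4) *+ (q == 0).
Proof.
have [->|pq] := eqVneq p q.
  rewrite subrr !expr0n /= invr0 !mulr0.
  have [->|q0] := eqVneq q 0; first by rewrite !expr0n /= invr0; ring.
  by rewrite /=; field.
have [->|p0] := eqVneq p 0.
  have [->|q0] := eqVneq q 0; first by rewrite !expr0n /= !invr0; ring.
  by rewrite !expr0n /= !invr0 sub0r subr0; field; rewrite oppr_eq0 q0.
have [->|q0] := eqVneq q 0.
  by rewrite !expr0n /= !invr0 sub0r subr0; field; rewrite oppr_eq0 p0.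
by rewrite !mulr0n; field; rewrite p0 q0 !subr_eq0 pq eq_sym pq.
Qed.

(** The left side vanishes on the diagonal, so no [p == q] term occurs. The constants
    [20 = 1 + 3 + 6 + 10] and [15 = 1 + 4 + 10] cancel what is left at [q = 0] and at [p = 0]. *)
Lemma partial_fraction33_42 p q :
  p ^- 3 * q ^- 3 - p ^- 4 * q ^- 2 =
    (20 * p ^- 6) *+ (q == 0) + (15 * q ^- 6) *+ (p == 0)
    - (p ^- 4 * (p - q) ^- 2 + 3 * (p ^- 3 * (p - q) ^- 3)
       + 6 * (p ^- 2 * (p - q) ^- 4) + 10 * (p ^- 1 * (p - q) ^- 5))
    - (q ^- 3 * (q - p) ^- 3 + 4 * (q ^- 2 * (q - p) ^- 4)
       + 10 * (q ^- 1 * (q - p) ^- 5)).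
Proof.
have [->|pq] := eqVneq p q.
  rewrite subrr !expr0n /= invr0 !mulr0.
  have [->|q0] := eqVneq q 0; first by rewrite !expr0n /= invr0; ring.
  by rewrite /=; field.
have [->|p0] := eqVneq p 0.
  have [->|q0] := eqVneq q 0; first by rewrite !expr0n /= !invr0; ring.
  by rewrite !expr0n /= !invr0 !sub0r !subr0; field; rewrite oppr_eq0 q0.
have [->|q0] := eqVneq q 0.
  by rewrite !expr0n /= !invr0 !sub0r !subr0; field; rewrite oppr_eq0 p0.
by rewrite !mulr0n; field; rewrite p0 q0 !subr_eq0 pq eq_sym pq.
Qed.

Lemma sum_indicator s (q : K) (x : K) : uniq s ->
  \sum_(p <- s) x *+ (p == q) = x *+ (q \in s).
Proof.
move=> us; have [qs|qs] := boolP (q \in s).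
  rewrite (bigD1_seq q) //= eqxx big1 ?addr0 // => p /negPf ->.
  by rewrite mulr0n.
rewrite big1_seq // => p /andP[_ ps].
by case: eqVneq ps qs => [-> ->|//].
Qed.

Definition inv_sum s k : K := \sum_(p <- s) p ^- k.

(** For [l > 0] the diagonal term [q = p] is [0 ^- l = 0], so it need not be excluded. *)
Definition inv_sum2 s k l : K :=
  \sum_(p <- s) p ^- k * \sum_(q <- s) (p - q) ^- l.

Lemma inv_sum2C s k l :
  \sum_(p <- s) \sum_(q <- s) q ^- k * (q - p) ^- l = inv_sum2 s k l.
Proof. by rewrite exchange_big; apply: eq_bigr => p _; rewrite mulr_sumr. Qed.

(** The diagonal gives [inv_sum s 4] once, and each of the two indicators at [0] takes it away three
    times, which leaves the factor [-5] when [0] is in [s]. *)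
Lemma inv_sum_sqr2 s : uniq s ->
  inv_sum s 2 ^+ 2 = (1 - 6 *+ (0 \in s)) * inv_sum s 4
    + 2 * inv_sum2 s 2 2 + 4 * inv_sum2 s 1 3.
Proof.
move=> us; rewrite expr2 big_distrlr /=.
under eq_bigr do under eq_bigr do rewrite partial_fraction22.
under eq_bigr do rewrite !(big_split, sumrN) -!mulr_sumr /=.
rewrite !(big_split, sumrN) -!mulr_sumr /= -!/(inv_sum2 s _ _) !inv_sum2C.
under [X in _ + X - _ - _]eq_big_seq => p ps.
  under eq_bigr do rewrite eq_sym.
  rewrite sum_indicator // ps; over.
under [X in _ - X]eq_bigr do rewrite sum_indicator //.
rewrite [X in _ - X - _]exchange_big /=.
under [X in _ - X - _]eq_bigr do rewrite sum_indicator //.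
rewrite !sumrMnl -!mulr_sumr -/(inv_sum s 4) mulr1n.
by case: (0 \in s); rewrite ?mulr1n ?mulr0n; ring.
Qed.

Lemma inv_sum_sqr3 s : uniq s ->
  inv_sum s 3 ^+ 2 - inv_sum s 4 * inv_sum s 2 =
    (35 * inv_sum s 6) *+ (0 \in s)
    - (inv_sum2 s 4 2 + 4 * inv_sum2 s 3 3 + 10 * inv_sum2 s 2 4
       + 20 * inv_sum2 s 1 5).
Proof.
move=> us; rewrite expr2 2!big_distrlr -sumrB /=.
under eq_bigr do rewrite -sumrB.
under eq_bigr do under eq_bigr do rewrite partial_fraction33_42.
under eq_bigr do rewrite !(big_split, sumrN) -!mulr_sumr /=.
rewrite !(big_split, sumrN) -!mulr_sumr /= -!/(inv_sum2 s _ _) !inv_sum2C.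
under eq_bigr do rewrite sum_indicator //.
rewrite [X in _ + X - _ - _]exchange_big /=.
under [X in _ + X - _ - _]eq_bigr do rewrite sum_indicator //.
rewrite !sumrMnl -!mulr_sumr -/(inv_sum s 6).
by case: (0 \in s); rewrite ?mulr1n ?mulr0n; ring.
Qed.

End PartialFractions.

(** * The Weierstrass relation on a finite symmetric index set, with exact error *)

Section SymmetricSums.
Variables (K : fieldType) (I : zmodType) (v : I -> K) (F : {fset I}).
Hypotheses (vN : {morph v : i / - i}) (v_inj : injective v).
Hypotheses (F0 : 0 \in F) (FN : forall i, (- i \in F) = (i \in F)).
Implicit Types (z : K) (k l : nat) (i j : I).

Lemma sum_opp (f : I -> K) : \sum_(i <- F) f (- i) = \sum_(i <- F) f i.
Proof.
rewrite -[LHS](big_map (fun i => - i) predT f); apply: perm_big.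
apply: uniq_perm; rewrite ?(map_inj_uniq oppr_inj) ?fset_uniq // => i.
by rewrite -[i in LHS]opprK (mem_map oppr_inj) FN.
Qed.

Lemma sum_odd (f : I -> K) : (2 : K) != 0 -> (forall i, f (- i) = - f i) ->
  \sum_(i <- F) f i = 0.
Proof.
move=> K2 fN; apply: (mulfI K2); rewrite mulr0 mulr_natl mulr2n.
by rewrite -{1}sum_opp -big_split big1 //= => i _; rewrite fN addNr.
Qed.

(** The failure of the sum over [F] to be invariant under translation by [i]. *)
Definition discrepancy k i :=
  \sum_(j <- F) (v j - v i) ^- k - \sum_(j <- F) v j ^- k.

(** The two quadratic identities are applied to the points [z - v i] and to the points [- v i]; both
    families have differences [v j - v i], hence share the inner sums. Of the factor 15, five come
    from [inv_sum_sqr2] at [- v i] and ten from the discrepancy of order 4. *)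
Lemma weierstrass_symmetric z (wp := \sum_(i <- F) ((z - v i) ^- 2 - v i ^- 2)) :
  (2 : K) != 0 -> (forall i, z != v i) ->
  (\sum_(i <- F) (z - v i) ^- 3) ^+ 2 - wp ^+ 3
    + 15 * (\sum_(i <- F) v i ^- 4) * wp + 35 * \sum_(i <- F) v i ^- 6 =
  - wp * (2 * \sum_(i <- F) ((z - v i) ^- 2 - v i ^- 2) * discrepancy 2 i
          + 4 * \sum_(i <- F) ((z - v i)^-1 + (v i)^-1 + z * v i ^- 2)
                            * discrepancy 3 i)
  - (\sum_(i <- F) (z - v i) ^- 4 * discrepancy 2 i
     + 4 * \sum_(i <- F) (z - v i) ^- 3 * discrepancy 3 i
     + 10 * \sum_(i <- F) ((z - v i) ^- 2 - v i ^- 2) * discrepancy 4 i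
     + 20 * \sum_(i <- F) ((z - v i)^-1 + (v i)^-1 + z * v i ^- 2)
                        * discrepancy 5 i
     + 4 * \sum_(i <- F) v i ^- 3 * discrepancy 3 i
     - \sum_(i <- F) v i ^- 4 * discrepancy 2 i).
Proof.
move=> K2 zv.
pose S l i := \sum_(j <- F) (v j - v i) ^- l.
have SN l i : S l (- i) = (-1) ^+ l * S l i.
  rewrite /S -sum_opp mulr_sumr; apply: eq_bigr => j _.
  by rewrite !vN -opprD [in LHS]exprNn invfM -exprVn invrN1.
have vVN k i : v (- i) ^- k = (-1) ^+ k * v i ^- k.
  by rewrite vN [in LHS]exprNn invfM -exprVn invrN1.
have G3 : \sum_(i <- F) v i ^- 3 = 0.
  by apply: sum_odd => // i; rewrite vVN; ring.
have G5 : \sum_(i <- F) v i ^- 5 = 0.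
  by apply: sum_odd => // i; rewrite vVN; ring.
(* These two parities allow [z * v i ^- 2] to be added to the coefficients of [S 3] and [S 5],
   turning them into summands of the Weierstrass zeta function, which decay cubically. *)
have V23 : \sum_(i <- F) v i ^- 2 * S 3 i = 0.
  by apply: sum_odd => // i; rewrite vVN SN; ring.
have V25 : \sum_(i <- F) v i ^- 2 * S 5 i = 0.
  by apply: sum_odd => // i; rewrite vVN SN; ring.
have inv_sum_map (f : I -> K) k :
    inv_sum [seq f i | i <- F] k = \sum_(i <- F) f i ^- k.
  by rewrite /inv_sum big_map.
have inv_sum2_map (f : I -> K) k l : (forall i j, f i - f j = v j - v i) ->
    inv_sum2 [seq f i | i <- F] k l = \sum_(i <- F) f i ^- k * S l i.
  move=> fv; rewrite /inv_sum2 big_map; apply: eq_bigr => i _.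
  by rewrite big_map; congr (_ * _); apply: eq_bigr => j _; rewrite fv.
pose s := [seq z - v i | i <- F]; pose t := [seq - v i | i <- F].
have us : uniq s.
  by rewrite map_inj_uniq ?fset_uniq // => i j /addrI/oppr_inj/v_inj.
have ut : uniq t by rewrite map_inj_uniq ?fset_uniq // => i j /oppr_inj/v_inj.
have s0 : (0 \in s) = false.
  by apply/mapP => -[i _ /eqP]; rewrite eq_sym subr_eq0 (negPf (zv i)).
have t0 : 0 \in t.
  apply/mapP; exists 0 => //; apply: (mulfI K2).
  by rewrite mulr0 mulr_natl mulr2n -{2}vN oppr0 addNr.
have tE k : \sum_(i <- F) (- v i) ^- k = (-1) ^+ k * \sum_(i <- F) v i ^- k.
  by rewrite mulr_sumr; apply: eq_bigr => i _; rewrite -vN vVN.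
have tSE k l : \sum_(i <- F) (- v i) ^- k * S l i =
    (-1) ^+ k * \sum_(i <- F) v i ^- k * S l i.
  by rewrite mulr_sumr; apply: eq_bigr => i _; rewrite -vN vVN mulrA.
have /eqP := inv_sum_sqr2 us; have /eqP := inv_sum_sqr3 us.
have /eqP := inv_sum_sqr2 ut; have /eqP := inv_sum_sqr3 ut.
rewrite s0 t0 !inv_sum_map !inv_sum2_map; do 8?[by move=> i j; ring].
rewrite !tE !tSE G3 => /eqP Et3 /eqP Et2 /eqP Es3 /eqP Es2.
have DE (f : I -> K) k : \sum_(i <- F) f i * discrepancy k i =
    \sum_(i <- F) f i * S k i - (\sum_(i <- F) f i) * \sum_(i <- F) v i ^- k.
  rewrite mulr_suml -sumrB; apply: eq_bigr => i _.
  by rewrite /discrepancy mulrBr.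
have coef2 k : \sum_(i <- F) ((z - v i) ^- 2 - v i ^- 2) * S k i =
    \sum_(i <- F) (z - v i) ^- 2 * S k i - \sum_(i <- F) v i ^- 2 * S k i.
  by rewrite -sumrB; apply: eq_bigr => i _; rewrite mulrBl.
have coef1 k : \sum_(i <- F) ((z - v i)^-1 + (v i)^-1 + z * v i ^- 2) * S k i =
    \sum_(i <- F) (z - v i) ^- 1 * S k i + \sum_(i <- F) v i ^- 1 * S k i
    + z * \sum_(i <- F) v i ^- 2 * S k i.
  rewrite mulr_sumr -!big_split /=; apply: eq_bigr => i _.
  by rewrite !mulrDl !expr1 mulrA.
rewrite !DE !coef2 !coef1 G3 G5 V23 V25 !mulr0 !subr0 !addr0.
have -> : wp = \sum_(i <- F) (z - v i) ^- 2 - \sum_(i <- F) v i ^- 2.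
  by rewrite /wp sumrB.
rewrite sumrB.
set x := \sum_(i <- F) (z - v i) ^- 2 - \sum_(i <- F) v i ^- 2.
(* The combination is [Es3 - x * Es2 + x * Et2 - Et3]; it eliminates the sum of [(z - v i) ^- 4] up
   to a discrepancy. *)
have comb (c l r a b : K) : l = r -> a - c * (l - r) = b -> a = b.
  by move=> ->; rewrite subrr mulr0 subr0.
apply: (comb 1 _ _ _ _ Es3); apply: (comb (- x) _ _ _ _ Es2).
apply: (comb x _ _ _ _ Et2); apply: (comb (- 1) _ _ _ _ Et3).
rewrite !(mulr0n, mulr1n) /x.
ring.
Qed.

End SymmetricSums.

(** * Square boxes and their shells in the sup norm *)

Section Boxes.
Implicit Types (i j : int * int) (k n : nat) (F : {fset int * int}).

Definition height i : nat := maxn `|i.1| `|i.2|.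

Lemma heightN i : height (- i) = height i.
Proof. by rewrite /height /=; lia. Qed.

Lemma leq_heightD i j : (height (i + j)%R <= height i + height j)%N.
Proof. by rewrite /height /=; lia. Qed.

Definition interval n : seq int := [seq a%:Z - n%:Z | a <- iota 0 n.*2.+1].

Lemma mem_interval n (x : int) : (x \in interval n) = (`|x| <= n)%N.
Proof.
apply/mapP/idP => [[a]|xn]; first by rewrite mem_iota => ? ->; lia.
by exists (absz (x + n%:Z)); rewrite ?mem_iota; lia.
Qed.

(** A shell is covered by four sides of [2 n + 1] points each, corners counted twice, so it has at
    most [8 n + 4] points. *)
Lemma size_shell (s : seq (int * int)) n :
  uniq s -> {in s, forall i, height i = n} -> (size s <= 8 * n.+1)%N.
Proof.
move=> us sn; pose ends := [:: n%:Z; - n%:Z].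
pose t := [seq (x, y) | x <- ends, y <- interval n]
          ++ [seq (x, y) | x <- interval n, y <- ends].
apply: (@leq_trans (size t)); last first.
  by rewrite size_cat !size_allpairs size_map size_iota /=; lia.
apply: uniq_leq_size us _ => -[x y] /sn; rewrite /height /= => xyn.
rewrite mem_cat; apply/orP.
have [xn|xn] := boolP (`|x|%N == n); [left|right]; apply/allpairsP;
  exists (x, y); split=> //=; rewrite ?mem_interval ?inE; lia.
Qed.

Definition box n : {fset int * int} :=
  seq_fset tt [seq (x, y) | x <- interval n, y <- interval n].

Lemma mem_box n i : (i \in box n) = (height i <= n)%N.
Proof.
rewrite seq_fsetE; apply/allpairsP/idP => [[j /= [+ +]]|].
  by rewrite !mem_interval => ? ? ->; rewrite /height /=; lia.
case: i => x y; rewrite /height /= => xyn.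
by exists (x, y); split=> //=; rewrite ?mem_interval; lia.
Qed.

End Boxes.

(** * Sums of functions of the height, and a harmonic convolution *)

Section HeightSums.
Variable R : realFieldType.
Implicit Types (k n : nat) (F : {fset int * int}).

(** The shift by one keeps decay bounds meaningful at the origin, of height [0]. *)
Definition recip n : R := n.+1%:R^-1.

Lemma recip_gt0 n : 0 < recip n.
Proof. by rewrite invr_gt0 ltr0n. Qed.

Lemma recip_le m n : (m <= n)%N -> recip n <= recip m.
Proof. by move=> mn; rewrite lef_pV2 ?posrE ?ltr0n // ler_nat. Qed.

(** The points are grouped by height, and [size_shell] bounds each group. *)
Lemma sum_height_le F a b (g : nat -> R) : (forall k, 0 <= g k) ->
  {in F, forall i, a <= height i < b}%N ->
  \sum_(i <- F) g (height i) <= 8 * \sum_(a <= k < b) k.+1%:R * g k.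
Proof.
move=> g0 Fab.
have -> : \sum_(i <- F) g (height i) =
    \sum_(a <= k < b) \sum_(i <- F | height i == k) g k.
  rewrite (exchange_big_dep predT) //=; apply: eq_big_seq => i iF.
  under eq_bigl do rewrite eq_sym.
  by rewrite big_nat1_eq Fab.
rewrite mulr_sumr; apply: ler_sum => k _.
rewrite -big_filter big_const_seq count_predT iter_addr_0.
rewrite -[leLHS]mulr_natl mulrA.
rewrite ler_wpM2r // -natrM ler_nat size_shell ?filter_uniq ?fset_uniq //.
by move=> i; rewrite mem_filter => /andP[/eqP].
Qed.

(** Each term is at most [k^-1 - (k + 1)^-1], and these differences telescope. *)
Lemma sum_recip_sqr_le a b : \sum_(a.+1 <= k < b) recip k ^+ 2 <= recip a.
Proof.
have [ab|ba] := leqP a.+1 b; last first.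
  by rewrite big_geq ?(ltnW ba) // ltW ?recip_gt0.
apply: (@le_trans _ _ (\sum_(a.+1 <= k < b) (- k.+1%:R^-1 - - k%:R^-1))).
  rewrite big_nat_cond [leRHS]big_nat_cond.
  apply: ler_sum => k /andP[/andP[ak _] _].
  have k0 : 0 < k%:R :> R by rewrite ltr0n (leq_ltn_trans _ ak).
  rewrite /recip -addn1 natrD -subr_ge0.
  have -> : - (k%:R + 1)^-1 - - k%:R^-1 - (k%:R + 1)^-1 ^+ 2 =
      k%:R^-1 * (k%:R + 1)^-1 ^+ 2 :> R.
    by field; rewrite !gt_eqF // ?addr_gt0.
  by rewrite mulr_ge0 ?sqr_ge0 // invr_ge0 ltW.
by rewrite telescope_sumr // opprK addrC gerBl invr_ge0 ler0n.
Qed.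

Lemma sum_height_cube_tail F n : {in F, forall i, n < height i}%N ->
  \sum_(i <- F) recip (height i) ^+ 3 <= 8 * recip n.
Proof.
move=> Fn; pose b := (\max_(i <- F) height i).+1.
have cube0 k : 0 <= recip k ^+ 3 by rewrite exprn_ge0 // ltW ?recip_gt0.
apply: le_trans (sum_height_le cube0 (a := n.+1) (b := b) _) _ => [i iF|].
  by rewrite Fn //= ltnS leq_bigmax_seq.
rewrite ler_wpM2l // (le_trans _ (sum_recip_sqr_le n b)) //.
apply: ler_sum => k _; rewrite le_eqVlt; apply/orP; left; apply/eqP.
by rewrite /recip exprS mulrA mulfV ?mul1r ?pnatr_eq0.
Qed.

(** The shell of height [0] and the tail beyond it contribute at most [8] each. *)
Lemma sum_height_cube F : \sum_(i <- F) recip (height i) ^+ 3 <= 16.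
Proof.
rewrite (big_fsetID _ (fun i => height i <= 0)%N) /=.
have -> : 16 = 8 + 8 :> R by ring.
apply: lerD; last first.
  have := @sum_height_cube_tail [fset i in F | ~~ (height i <= 0)%N]%fset 0.
  rewrite /recip invr1 mulr1; apply => i.
  by rewrite !inE -ltnNge => /andP[].
have := @sum_height_le [fset i in F | (height i <= 0)%N]%fset 0 1
  (fun k => recip k ^+ 3).
rewrite big_nat1 /recip invr1 expr1n !mulr1; apply.
  by move=> k; rewrite exprn_ge0 // invr_ge0.
by move=> i; rewrite !inE => /andP[].
Qed.

(* A square number of terms bounds the harmonic sum by [2 (k + 1)] without
   logarithms. *)
Lemma sum_recip_mul_sub_le k n : n.+1 = (k.+1 ^ 2)%N ->
  \sum_(0 <= j < n.+1) recip j * recip (n - j) <= 4 * recip k.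
Proof.
move=> nE.
(* The first [k] terms are at most [1], the later ones at most [recip k]. *)
have harmonic m : \sum_(0 <= j < m) recip j <= (minn m k)%:R + m%:R * recip k.
  elim: m => [|m IHm]; first by rewrite big_geq // min0n mul0r addr0.
  rewrite big_nat_recr //= -[m.+1 in leRHS]addn1 natrD mulrDl mul1r addrA.
  have [mk|km] := ltnP m k.
    have -> : minn (m + 1) k = (minn m k).+1 by lia.
    have : recip m <= 1 by rewrite invf_le1 ?ltr0n // ler1n.
    have := recip_gt0 k; rewrite -addn1 natrD; lra.
  have -> : minn (m + 1) k = minn m k by lia.
  by have := recip_le km; lra.
(* The denominators [j + 1] and [n - j + 1] add up to [n + 2], so each product is [recip n.+1] times
   the sum of its factors; reflection identifies the two resulting sums. *)
have -> : \sum_(0 <= j < n.+1) recip j * recip (n - j) =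
    2 * recip n.+1 * \sum_(0 <= j < n.+1) recip j.
  have -> : 2 * recip n.+1 * \sum_(0 <= j < n.+1) recip j =
      recip n.+1 * (\sum_(0 <= j < n.+1) recip j
                    + \sum_(0 <= j < n.+1) recip (n - j)).
    have -> : \sum_(0 <= j < n.+1) recip (n - j) = \sum_(0 <= j < n.+1) recip j.
      rewrite big_nat_rev; apply: eq_big_nat => j /andP[_ jn] /=.
      by rewrite add0n subSS subKn.
    ring.
  rewrite -big_split mulr_sumr /= !big_nat; apply: eq_bigr => j /andP[_ jn].
  rewrite /recip -!natr1 natrB //.
  have j0 : 0 <= j%:R :> R by [].
  have : j%:R <= n%:R :> R by rewrite ler_nat.
  move=> jn'; field; rewrite !gt_eqF //; lra.
have sum_le : \sum_(0 <= j < n.+1) recip j <= 2 * k.+1%:R.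
  apply: le_trans (harmonic _) _.
  have : (minn n.+1 k)%:R <= k%:R :> R by rewrite ler_nat geq_minr.
  rewrite nE /recip natrX expr2 mulfK ?pnatr_eq0 // -natr1; lra.
apply: le_trans (ler_wpM2l _ sum_le) _; first by rewrite mulr_ge0 // invr_ge0.
rewrite /recip nE -[(_ ^ _).+1%:R]natr1 natrX; set x := k.+1%:R.
have x1 : 1 <= x by rewrite ler1n.
rewrite -subr_ge0.
have -> : 4 * x^-1 - 2 * (x ^+ 2 + 1)^-1 * (2 * x) = 4 * x^-1 * (x ^+ 2 + 1)^-1.
  by field; rewrite !gt_eqF //; nra.
by rewrite !mulr_ge0 // invr_ge0; nra.
Qed.

End HeightSums.

(** * The real-valued modulus of complex numbers *)

Section Normc.
Import ComplexField.Normc.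
Variable R : realType.
Implicit Types (x y : R[i]).

Lemma normc_ge0 x : 0 <= normc x.
Proof. by case: x => a b; apply: sqrtr_ge0. Qed.

Lemma normcX k x : normc (x ^+ k) = normc x ^+ k.
Proof.
by elim: k => [|k IHk]; rewrite ?expr0 ?normc1 // !exprS normcM IHk.
Qed.

Lemma normc_sum (I : Type) (s : seq I) (f : I -> R[i]) :
  normc (\sum_(i <- s) f i) <= \sum_(i <- s) normc (f i).
Proof.
elim/big_rec2: _ => [|i y x _ IH]; first by rewrite normc0.
exact: le_trans (le_normcD _ _) (lerD _ IH).
Qed.

Lemma le_normcB x y : normc (x - y) <= normc x + normc y.
Proof. by rewrite -(normcN y) le_normcD. Qed.

Lemma normc_real (a : R) : normc a%:C%C = `|a|.
Proof. by rewrite /normc /= expr0n addr0 sqrtr_sqr. Qed.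

Lemma normc_nat n : normc n%:R = n%:R :> R.
Proof. by rewrite -(rmorph_nat (real_complex R)) normc_real ger0_norm. Qed.

Lemma normc_Im_le x : `|complex.Im x| <= normc x.
Proof.
by case: x => a b /=; rewrite -sqrtr_sqr ler_wsqrtr // lerDr sqr_ge0.
Qed.

Lemma normc_Re_le x : `|complex.Re x| <= normc x.
Proof.
by case: x => a b /=; rewrite -sqrtr_sqr ler_wsqrtr // lerDl sqr_ge0.
Qed.

End Normc.

(** * Comparison of lattice points with their heights *)

Section Estimates.
Import ComplexField.Normc.
Variables (R : realType) (mu z : R[i]).
Hypotheses (hmu : mu \isn't Num.real) (hz : ~ lattice mu z).
Implicit Types (i j : int * int) (F : {fset int * int}).

Local Notation v := (lattice_pt mu).
Local Notation u i := (recip R (height i)).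

Lemma lattice_ptD i j : v (i + j) = v i + v j.
Proof. by rewrite /lattice_pt /= !rmorphD /=; ring. Qed.

Lemma lattice_ptN : {morph v : i / - i}.
Proof. by move=> i; rewrite /lattice_pt /= !rmorphN /=; ring. Qed.

Lemma lattice_pt_neq i : z != v i.
Proof.
by apply/eqP => zE; apply: hz; exists i.2, i.1; rewrite zE /lattice_pt addrC.
Qed.

(** Since [mu] is not real, the imaginary part of [v i] controls [i.1]; the real part then controls
    [i.2]. *)
Lemma height_le_lattice_pt : exists2 A : R, 0 < A &
  forall i, (height i)%:R <= A * normc (v i).
Proof.
have Im_neq0 : complex.Im mu != 0.
  by move: hmu; case: (mu) => a b; rewrite complex_real.
set b := `|complex.Im mu|; have b0 : 0 < b by rewrite normr_gt0.
set a := `|complex.Re mu|; have a0 : 0 <= a by apply: normr_ge0.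
exists (1 + (1 + a) / b).
  by rewrite ltr_wpDr // divr_ge0 // ltW // ltr_wpDr.
move=> i; have n0 := normc_ge0 (v i).
have := normc_Im_le (v i); have := normc_Re_le (v i).
have -> : complex.Im (v i) = i.1%:~R * complex.Im mu.
  rewrite /lattice_pt -!(rmorph_int (real_complex R)).
  by case: (mu) => ? ? /=; simpc.
have -> : complex.Re (v i) = i.1%:~R * complex.Re mu + i.2%:~R.
  rewrite /lattice_pt -!(rmorph_int (real_complex R)).
  by case: (mu) => ? ? /=; simpc.
rewrite normrM -/b => Re_le Im_le.
have m_le : `|i.1%:~R| <= normc (v i) / b :> R by rewrite ler_pdivlMr.
have n_le : `|i.2%:~R| <= normc (v i) + a * (normc (v i) / b) :> R.
  have := ler_normB (i.1%:~R * complex.Re mu + i.2%:~R)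
                    (i.1%:~R * complex.Re mu).
  rewrite addrAC subrr add0r normrM -/a => /le_trans; apply.
  by rewrite lerD // mulrC ler_wpM2l.
have -> : (height i)%:R = Num.max `|i.1%:~R| `|i.2%:~R| :> R.
  rewrite /height natr_max; congr Num.max;
  by rewrite natr_absz intr_norm.
have nb : 0 <= normc (v i) / b by rewrite divr_ge0 // ltW.
have -> : (1 + (1 + a) / b) * normc (v i) =
   normc (v i) + normc (v i) / b + a * (normc (v i) / b) by ring.
have : 0 <= a * (normc (v i) / b) by rewrite mulr_ge0.
by rewrite ge_max => ?; apply/andP; split; lra.
Qed.

Lemma recip_bounds : exists2 A : R, 1 <= A &
  forall i, normc (v i)^-1 <= A * u i /\ normc (z - v i)^-1 <= A * u i.
Proof.
have [A A0 hA] := height_le_lattice_pt.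
have inv_le c y h : h.+1%:R <= c * normc y -> normc y^-1 <= c * recip R h.
  move=> hy; have y0 : 0 < normc y.
    rewrite lt_neqAle normc_ge0 andbT eq_sym; apply/eqP => y0.
    by move: hy; rewrite y0 mulr0 real_leNgt ?ltr0n // realE.
  by rewrite normcV /recip ler_pdivlMr ?ltr0n // mulrC ler_pdivrMr.
(* Beyond height [n] the term [A * normc z] is less than half the height, so
   [height i < 2 * A * normc (z - v i)]. The finitely many remaining points are absorbed into
   [B]. *)
pose n := Num.bound (2 * A * normc z).
have n_gt : 2 * A * normc z < n%:R.
  by rewrite archi_boundP // mulr_ge0 ?normc_ge0 // mulr_ge0 // ltW.
pose B := \sum_(i <- box n) normc (z - v i)^-1 * (height i).+1%:R.
have B_ge0 : 0 <= B.
  by apply: sumr_ge0 => i _; rewrite mulr_ge0 ?normc_ge0.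
have u0 h : 0 <= recip R h by rewrite ltW ?recip_gt0.
exists (1 + 4 * A + B) => [|i]; first by rewrite -addrA lerDl; lra.
have enlarge c x : c <= 1 + 4 * A + B -> x <= c * u i ->
    x <= (1 + 4 * A + B) * u i.
  by move=> cle /le_trans; apply; rewrite ler_wpM2r.
have := hA i; set h := height i => hAi; split.
  have [h0|h_gt0] := posnP h.
    have -> : v i = 0.
      move: h0; rewrite /h /height; case: (i) => x y /= xy0.
      have -> : x = 0 by lia.
      have -> : y = 0 by lia.
      by rewrite /lattice_pt mul0r addr0.
    by rewrite invr0 normc0 mulr_ge0 // -/h; lra.
  apply: (enlarge (2 * A)); first by lra.
  apply: inv_le; rewrite -/h -natr1.
  have : 1 <= h%:R :> R by rewrite ler1n.
  lra.
have [hn|nh] := leqP h n.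
  apply: (enlarge B); first by lra.
  rewrite /recip ler_pdivlMr ?ltr0n // /B (big_fsetD1 i) ?mem_box //=.
  by rewrite lerDl sumr_ge0 // => j _; rewrite mulr_ge0 ?normc_ge0.
apply: (enlarge (4 * A)); first by lra.
apply: inv_le; rewrite -/h -natr1.
have : n.+1%:R <= h%:R :> R by rewrite ler_nat.
have : normc (v i) <= normc z + normc (z - v i).
  by have := le_normcB z (z - v i); rewrite opprB addrC subrK.
rewrite -natr1; have := ler0n R n.
move: (normc _) (normc _) (normc _) hAi n_gt => x y w.
nra.
Qed.

Lemma lattice_pt_eq0 i : v i = 0 -> i = 0.
Proof.
move=> vi0; have [A _ /(_ i)] := height_le_lattice_pt.
rewrite vi0 normc0 mulr0 (_ : 0 = 0%:R) // ler_nat.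
by case: (i) => x y; rewrite /height /= => xy0; congr (_, _); lia.
Qed.

Lemma lattice_pt_inj : injective v.
Proof.
move=> i j vij; apply/eqP; rewrite -subr_eq0; apply/eqP/lattice_pt_eq0.
by rewrite lattice_ptD lattice_ptN vij subrr.
Qed.

End Estimates.

(** * Bounds for discrepancies and for cubically decaying sums *)

Section Bounds.
Import ComplexField.Normc.
Variables (R : realType) (mu : R[i]) (A : R).
Hypothesis A_ge1 : 1 <= A.
Implicit Types (i j : int * int) (F : {fset int * int}) (f : int * int -> R[i]).

Local Notation v := (lattice_pt mu).
Local Notation u i := (recip R (height i)).

Hypothesis v_bound : forall i, normc (v i)^-1 <= A * u i.

Lemma recip_le1 n : recip R n <= 1.
Proof. by rewrite invf_le1 ?ltr0n // ler1n. Qed.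

Let A_ge0 : 0 <= A.
Proof. exact: le_trans A_ge1. Qed.

Let u_ge0 n : 0 <= recip R n.
Proof. by rewrite ltW ?recip_gt0. Qed.

Lemma normc_invX_le k m n (x : R[i]) : (m <= k)%N ->
  normc x^-1 <= A * recip R n -> normc (x ^- k) <= A ^+ k * recip R n ^+ m.
Proof.
move=> mk xn; rewrite -exprVn normcX.
apply: (@le_trans _ _ ((A * recip R n) ^+ k)).
  by rewrite lerXn2r ?nnegrE ?normc_ge0 // mulr_ge0.
rewrite exprMn ler_wpM2l ?exprn_ge0 //.
by rewrite ler_wiXn2l ?recip_le1.
Qed.

(** Common points of the box and its translate cancel. Each of the two differences lies in
    [2 * height i] shells, and a shell carries at most [8 * A ^+ k * recip R (n - height i)]. *)
Lemma normc_discrepancy_le n k i : (1 < k)%N -> (height i <= n)%N ->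
  normc (discrepancy v (box n) k i)
    <= 32 * A ^+ k * ((height i).+1%:R * recip R (n - height i)).
Proof.
set h := height i => k1 hn.
(* The box and its translate differ only at heights in [(n - h, n + h]]. *)
have annulus F : {in F, forall r, n - h < height r < (n + h).+1}%N ->
    normc (\sum_(r <- F) v r ^- k)
      <= 16 * A ^+ k * (h.+1%:R * recip R (n - h)).
  move=> Fnh; apply: le_trans (normc_sum _ _) _.
  apply: (@le_trans _ _ (\sum_(r <- F) A ^+ k * u r ^+ 2)).
    by apply: ler_sum => r _; apply: normc_invX_le.
  rewrite -mulr_sumr -mulrA mulrCA ler_wpM2l ?exprn_ge0 //.
  have sqr0 m : 0 <= recip R m ^+ 2 by rewrite exprn_ge0.
  apply: le_trans (sum_height_le sqr0 Fnh) _.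
  apply: (@le_trans _ _
      (8 * \sum_((n - h).+1 <= m < (n + h).+1) recip R (n - h))).
    rewrite ler_wpM2l // big_nat_cond [leRHS]big_nat_cond.
    apply: ler_sum => m /andP[/andP[nm _] _].
    rewrite expr2 mulrA {1}/recip mulfV ?pnatr_eq0 // mul1r recip_le //.
    exact: ltnW.
  rewrite sumr_const_nat -[X in 8 * X]mulr_natl.
  have -> : ((n + h).+1 - (n - h).+1 = h + h)%N by lia.
  have := u_ge0 (n - h); rewrite natrD -natr1.
  by have := ler0n R h; nra.
pose B := [fset j - i | j in box n]%fset.
have -> : discrepancy v (box n) k i =
    \sum_(r <- [fset r in B | r \notin box n]%fset) v r ^- k
    - \sum_(r <- [fset r in box n | r \notin B]%fset) v r ^- k.
  rewrite /discrepancy.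
  have -> : \sum_(j <- box n) (v j - v i) ^- k = \sum_(r <- B) v r ^- k.
    rewrite big_imfset /=; last by move=> j j' _ _ /addIr.
    by apply: eq_bigr => j _; rewrite lattice_ptD lattice_ptN.
  rewrite (big_fsetID _ (mem (box n)) B) (big_fsetID _ (mem B) (box n)) /=.
  have -> : [fset r in B | r \in box n]%fset = [fset r in box n | r \in B]%fset.
    by apply/fsetP => r; rewrite !inE andbC.
  by rewrite opprD addrACA subrr add0r.
apply: le_trans (le_normcB _ _) _.
have -> : 32 * A ^+ k * (h.+1%:R * recip R (n - h)) =
  16 * A ^+ k * (h.+1%:R * recip R (n - h))
  + 16 * A ^+ k * (h.+1%:R * recip R (n - h)) by ring.
apply: lerD; apply: annulus => r; rewrite !inE mem_box.
  rewrite -ltnNge => /andP[/imfsetP[j /=]]; rewrite mem_box => jn -> nr.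
  have := leq_heightD j (- i); rewrite heightN -/h => jih.
  rewrite (leq_ltn_trans (leq_subr _ _) nr) ltnS (leq_trans jih) //.
  by rewrite leq_add2r.
move=> /andP[rn rB]; apply/andP; split; last by lia.
rewrite ltnNge; apply: contra rB => rnh; apply/imfsetP.
exists (r + i); rewrite ?addrK // mem_box.
by apply: leq_trans (leq_heightD r i) _; rewrite -/h; lia.
Qed.

(** The discrepancy costs one power of the height and the shell size another, so [u i ^+ 3] leaves
    the convolution bounded by [sum_recip_mul_sub_le]. The constant is [1024 = 32 * 8 * 4]. *)
Lemma sum_mul_discrepancy_le (C : R) f k n m :
  (1 < k <= 5)%N -> n.+1 = (m.+1 ^ 2)%N -> 0 <= C ->
  (forall i, normc (f i) <= C * u i ^+ 3) ->
  normc (\sum_(i <- box n) f i * discrepancy v (box n) k i)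
    <= 1024 * A ^+ 5 * C * recip R m.
Proof.
move=> /andP[k1 k5] nm C0 fC.
have Ak : A ^+ k <= A ^+ 5 by rewrite ler_weXn2l.
have A0 : 0 <= A ^+ 5 by rewrite exprn_ge0.
pose g h := recip R h ^+ 2 * recip R (n - h).
have g0 h : 0 <= g h by rewrite mulr_ge0 ?exprn_ge0.
apply: le_trans (normc_sum _ _) _.
apply: (@le_trans _ _ (\sum_(i <- box n) 32 * A ^+ 5 * C * g (height i))).
  rewrite big_seq [leRHS]big_seq; apply: ler_sum => i; rewrite mem_box => hin.
  rewrite normcM; apply: (@le_trans _ _ (C * u i ^+ 3
      * (32 * A ^+ 5 * ((height i).+1%:R * recip R (n - height i))))).
    apply: ler_pM; rewrite ?normc_ge0 //.
    apply: le_trans (normc_discrepancy_le k1 hin) _.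
    by rewrite ler_wpM2r ?mulr_ge0 // ler_wpM2l.
  rewrite /g [u i ^+ 3]exprS le_eqVlt; apply/orP; left; apply/eqP.
  have := mulVf (lt0r_neq0 (ltr0Sn R (height i))).
  rewrite -/(recip R (height i)) => uh.
  by transitivity (32 * A ^+ 5 * C * (u i ^+ 2 * recip R (n - height i))
    * (u i * (height i).+1%:R)); [ring | rewrite uh mulr1].
rewrite -mulr_sumr.
have -> : 1024 * A ^+ 5 * C * recip R m =
  32 * A ^+ 5 * C * (8 * (4 * recip R m)) by ring.
rewrite ler_wpM2l ?mulr_ge0 //.
apply: le_trans (sum_height_le g0 (a := 0) (b := n.+1) _) _ => [i|].
  by rewrite mem_box ltnS.
rewrite ler_wpM2l // (le_trans _ (sum_recip_mul_sub_le R nm)) //.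
rewrite le_eqVlt; apply/orP; left; apply/eqP; apply: eq_bigr => h _.
by rewrite /g expr2 !mulrA [_%:R * _]mulfV ?mul1r ?pnatr_eq0.
Qed.

Lemma sum_cubic_le (C : R) f F : 0 <= C ->
  (forall i, normc (f i) <= C * u i ^+ 3) ->
  normc (\sum_(i <- F) f i) <= 16 * C.
Proof.
move=> C0 fC; apply: le_trans (normc_sum _ _) _.
apply: le_trans (ler_sum _ (fun i _ => fC i)) _.
by rewrite -mulr_sumr mulrC ler_wpM2r ?sum_height_cube.
Qed.

Lemma sum_cubic_sub_le (C : R) f F n : 0 <= C ->
  (forall i, normc (f i) <= C * u i ^+ 3) -> (box n `<=` F)%fset ->
  normc (\sum_(i <- F) f i - \sum_(i <- box n) f i) <= 8 * C * recip R n.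
Proof.
move=> C0 fC /fsubsetP nF.
rewrite (big_fsetID _ (mem (box n)) F) /=.
have -> : [fset i in F | i \in box n]%fset = box n.
  by apply/fsetP => i; rewrite !inE andb_idl // => /nF.
rewrite addrAC subrr add0r; apply: le_trans (normc_sum _ _) _.
apply: le_trans (ler_sum _ (fun i _ => fC i)) _.
rewrite -mulr_sumr [8 * C]mulrC -mulrA ler_wpM2l //.
by apply: sum_height_cube_tail => i; rewrite !inE mem_box -ltnNge => /andP[].
Qed.

End Bounds.

(** * The normalised Weierstrass polynomial and its Lipschitz bound *)

Section Cubic.
Import ComplexField.Normc.
Variable R : realType.
Implicit Types (x y : R[i]) (a b : R).

(** A quarter of [weierstrassE] for [x = X - g1] and [y = - Y / 2], with [15 = 60 / 4] and
    [35 = 140 / 4]. *)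
Definition weierstrass_cubic x y g h : R[i] :=
  y ^+ 2 - x ^+ 3 + 15 * g * x + 35 * h.

Lemma normcD_le x y a b :
  normc x <= a -> normc y <= b -> normc (x + y) <= a + b.
Proof. by move=> xa yb; apply: le_trans (le_normcD _ _) (lerD xa yb). Qed.

Lemma normcM_le x y a b :
  normc x <= a -> normc y <= b -> normc (x * y) <= a * b.
Proof. by move=> xa yb; rewrite normcM ler_pM ?normc_ge0. Qed.

Lemma normcB_le x y a b :
  normc x <= a -> normc y <= b -> normc (x - y) <= a + b.
Proof. by move=> xa yb; apply: le_trans (le_normcB _ _) (lerD xa yb). Qed.

Lemma normc_natr n : normc (n%:R : R[i]) <= n%:R.
Proof. by rewrite normc_nat. Qed.

(** Every product in the difference gets one small factor: [2 M] comes from the square, [3 M^2] from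
    the cube, [30 M] from the mixed term. *)
Lemma weierstrass_cubic_lipschitz (x y g h x' y' g' h' : R[i]) (M e : R) :
  normc x <= M -> normc y <= M -> normc x' <= M -> normc y' <= M ->
  normc g' <= M ->
  normc (x - x') <= e -> normc (y - y') <= e -> normc (g - g') <= e ->
  normc (h - h') <= e ->
  normc (weierstrass_cubic x y g h - weierstrass_cubic x' y' g' h')
    <= (3 * M ^+ 2 + 32 * M + 35) * e.
Proof.
move=> xM yM xM' yM' gM' xe ye ge he.
have -> : weierstrass_cubic x y g h - weierstrass_cubic x' y' g' h' =
    (y - y') * (y + y') + (x' - x) * (x * x + x * x' + x' * x')
    + 15%:R * ((g - g') * x + g' * (x - x')) + 35%:R * (h - h').
  by rewrite /weierstrass_cubic; ring.
have -> : (3 * M ^+ 2 + 32 * M + 35) * e =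
    e * (M + M) + e * (M * M + M * M + M * M)
    + 15%:R * (e * M + M * e) + 35%:R * e by ring.
have xe' : normc (x' - x) <= e by rewrite -opprB normcN.
exact: normcD_le (normcD_le (normcD_le
  (normcM_le ye (normcD_le yM yM'))
  (normcM_le xe' (normcD_le (normcD_le (normcM_le xM xM) (normcM_le xM xM'))
    (normcM_le xM' xM'))))
  (normcM_le (normc_natr 15) (normcD_le (normcM_le ge xM) (normcM_le gM' xe))))
  (normcM_le (normc_natr 35) he).
Qed.

End Cubic.

(** * The explicit bound on boxes and on all larger finite sets *)

Section WeierstrassBound.
Import ComplexField.Normc.
Variables (R : realType) (mu z : R[i]) (A : R).
Hypotheses (hmu : mu \isn't Num.real) (hz : ~ lattice mu z) (A_ge1 : 1 <= A).
Implicit Types (i j : int * int) (F : {fset int * int}).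

Local Notation v := (lattice_pt mu).
Local Notation u i := (recip R (height i)).

Hypothesis v_bound : forall i, normc (v i)^-1 <= A * u i.
Hypothesis zv_bound : forall i, normc (z - v i)^-1 <= A * u i.

Let wp F := \sum_(i <- F) ((z - v i) ^- 2 - v i ^- 2).
Let P3 F := \sum_(i <- F) (z - v i) ^- 3.
Let G F k := \sum_(i <- F) v i ^- k.

Lemma lattice_pt0 : v 0 = 0.
Proof. by rewrite /lattice_pt mul0r addr0. Qed.

(** The origin contributes [0 ^- k = 0], so the punctured sums agree with the full ones, and [wp F]
    is [wp_nc mu F z] shifted by [g1]. *)
Lemma weierstrassE_cubic F : 0 \in F ->
  weierstrassE mu F (wp_nc mu F z) (wp_nc' mu F z) =
  4 * weierstrass_cubic (wp F) (P3 F) (G F 4) (G F 6).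
Proof.
move=> F0.
have GE k : \sum_(p <- (F `\ (0%R, 0%R))%fset) v p ^- k.+1 = G F k.+1.
  by rewrite /G [RHS](big_fsetD1 0) //= lattice_pt0 expr0n invr0 add0r.
rewrite /weierstrassE /g1 /g2 /g3 !GE /wp_nc /wp_nc' -/(P3 F).
have -> : \sum_(p <- F) (z - v p) ^- 2 = wp F + G F 2.
  by rewrite /wp /G -big_split /=; apply: eq_bigr => i _; rewrite subrK.
rewrite /weierstrass_cubic; ring.
Qed.

(** One constant dominates [A ^+ 6], [2 * normc z * A ^+ 3] and [normc z ^+ 2 * A ^+ 3], which the
    summands below require. *)
Let C := 2 * (1 + normc z) ^+ 2 * A ^+ 6.

Let A_ge0 : 0 <= A.
Proof. exact: le_trans A_ge1. Qed.

Let u3_ge0 n : 0 <= recip R n ^+ 3.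
Proof. by rewrite exprn_ge0 // ltW ?recip_gt0. Qed.

Let pow_le k (x : R[i]) n : (3 <= k <= 6)%N -> normc x^-1 <= A * recip R n ->
  normc (x ^- k) <= C * recip R n ^+ 3.
Proof.
move=> /andP[k3 k6] xn.
apply: le_trans (normc_invX_le A_ge1 k3 xn) _.
rewrite ler_wpM2r ?u3_ge0 //.
apply: (@le_trans _ _ (A ^+ 6)); first by rewrite ler_weXn2l.
by rewrite ler_peMl ?exprn_ge0 //; have := normc_ge0 z; nra.
Qed.

Let A6_le : A ^+ 6 <= C.
Proof. by rewrite ler_peMl ?exprn_ge0 //; have := normc_ge0 z; nra. Qed.

Let C_ge0 : 0 <= C.
Proof. by apply: le_trans A6_le; rewrite exprn_ge0. Qed.

Let wp_le i : normc ((z - v i) ^- 2 - v i ^- 2) <= C * u i ^+ 3.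
Proof.
have [vi0|vi0] := eqVneq (v i) 0.
  have u1 : u i = 1 by rewrite (lattice_pt_eq0 hmu vi0) /recip invr1.
  have := zv_bound i; rewrite vi0 !subr0 expr0n invr0 subr0 u1 expr1n !mulr1.
  rewrite -exprVn normcX => zA.
  apply: (@le_trans _ _ (A ^+ 2)); first by rewrite lerXn2r ?nnegrE ?normc_ge0.
  apply: (@le_trans _ _ (A ^+ 6)); first by rewrite ler_weXn2l.
  exact: A6_le.
have zvi : z - v i != 0 by rewrite subr_eq0 lattice_pt_neq.
(* The difference of squares factors, and the sum [(z - v i)^-1 + (v i)^-1] equals
   [z * (z - v i)^-1 * (v i)^-1], which supplies the extra decay. *)
have -> : (z - v i) ^- 2 - v i ^- 2 =
    z * ((z - v i)^-1 * (v i)^-1 * ((z - v i)^-1 - (v i)^-1)).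
  by field; rewrite vi0.
apply: (@le_trans _ _
    (normc z * ((A * u i) * (A * u i) * (A * u i + A * u i)))).
  rewrite !normcM ler_wpM2l ?normc_ge0 // ler_pM ?mulr_ge0 ?normc_ge0 //.
    by rewrite ler_pM ?normc_ge0.
  exact: le_trans (le_normcB _ _) (lerD _ _).
have -> : normc z * ((A * u i) * (A * u i) * (A * u i + A * u i)) =
  2 * normc z * A ^+ 3 * u i ^+ 3 by ring.
rewrite ler_wpM2r ?u3_ge0 // /C ler_pM ?ler_weXn2l ?exprn_ge0 ?mulr_ge0
  ?normc_ge0 //.
by have := normc_ge0 z; nra.
Qed.

Let zeta_le i :
  normc ((z - v i)^-1 + (v i)^-1 + z * v i ^- 2) <= C * u i ^+ 3.
Proof.
have [vi0|vi0] := eqVneq (v i) 0.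
  have u1 : u i = 1 by rewrite (lattice_pt_eq0 hmu vi0) /recip invr1.
  have := zv_bound i; rewrite vi0 !subr0 expr0n !invr0 mulr0 !addr0 u1.
  rewrite expr1n !mulr1 => zA.
  apply: le_trans zA _; apply: le_trans A6_le.
  by rewrite -{1}[A]expr1 ler_weXn2l.
have zvi : z - v i != 0 by rewrite subr_eq0 lattice_pt_neq.
have -> : (z - v i)^-1 + (v i)^-1 + z * v i ^- 2 =
    z * z * ((z - v i)^-1 * (v i)^-1 * (v i)^-1).
  by field; rewrite vi0.
apply: (@le_trans _ _
    (normc z * normc z * ((A * u i) * (A * u i) * (A * u i)))).
  rewrite !normcM ler_wpM2l ?mulr_ge0 ?normc_ge0 //.
  rewrite ler_pM ?mulr_ge0 ?normc_ge0 //.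
  by rewrite ler_pM ?normc_ge0.
have -> : normc z * normc z * ((A * u i) * (A * u i) * (A * u i)) =
  normc z * normc z * A ^+ 3 * u i ^+ 3 by ring.
rewrite ler_wpM2r ?u3_ge0 // /C ler_pM ?ler_weXn2l ?exprn_ge0 ?mulr_ge0
  ?normc_ge0 //.
by have := normc_ge0 z; nra.
Qed.

Let box_bound := 1024 * A ^+ 5 * C.

(** In the exact error each discrepancy sum is at most [box_bound * recip R m]; the weights are
    [6 = 2 + 4] and [40 = 1 + 4 + 10 + 20 + 4 + 1]. *)
Lemma weierstrass_cubic_box n m : n.+1 = (m.+1 ^ 2)%N ->
  normc (weierstrass_cubic (wp (box n)) (P3 (box n)) (G (box n) 4) (G (box n) 6))
    <= (16 * C * 6 + 40) * (box_bound * recip R m).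
Proof.
move=> nm; set e := box_bound * recip R m.
have boxN i : (- i \in box n) = (i \in box n) by rewrite !mem_box heightN.
have two_neq0 : (2 : R[i]) != 0 by rewrite pnatr_eq0.
have D_le f k : (1 < k <= 5)%N ->
    (forall i, normc (f i) <= C * u i ^+ 3) ->
    normc (\sum_(i <- box n) f i * discrepancy v (box n) k i) <= e.
  by move=> k5 fC; apply: sum_mul_discrepancy_le.
rewrite /weierstrass_cubic (weierstrass_symmetric (@lattice_ptN _ mu)
  (lattice_pt_inj hmu) _ boxN two_neq0 (lattice_pt_neq hz)); last first.
  by rewrite mem_box.
have wpN : normc (- wp (box n)) <= 16 * C by rewrite normcN sum_cubic_le.
rewrite -/(wp (box n)).
have -> : (16 * C * 6 + 40) * e = 16 * C * (2%:R * e + 4%:R * e)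
    + (e + 4%:R * e + 10%:R * e + 20%:R * e + 4%:R * e + e) by ring.
have p_le k : (3 <= k <= 6)%N ->
    forall i, normc ((z - v i) ^- k) <= C * u i ^+ 3.
  by move=> k36 i; apply: pow_le.
have v_le k : (3 <= k <= 6)%N -> forall i, normc (v i ^- k) <= C * u i ^+ 3.
  by move=> k36 i; apply: pow_le.
have nat_mul k x : normc x <= e -> normc (k%:R * x) <= k%:R * e.
  by move=> xe; exact: normcM_le (normc_natr R k) xe.
apply: normcB_le.
  apply: normcM_le wpN _.
  by apply: normcD_le; apply: nat_mul; apply: D_le.
apply: normcB_le; last by apply: D_le => //; apply: v_le.
apply: normcD_le; last by apply: nat_mul; apply: D_le => //; apply: v_le.
apply: normcD_le; last by apply: nat_mul; apply: D_le.
apply: normcD_le; last by apply: nat_mul; apply: D_le.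
apply: normcD_le; last by apply: nat_mul; apply: D_le => //; apply: p_le.
by apply: D_le => //; apply: p_le.
Qed.

(** Passing from the box to [F] moves each of the four sums by at most [8 * C * recip R m], and the
    Lipschitz bound applies with [M = 16 * C]. *)
Lemma weierstrassE_bound n m F : n.+1 = (m.+1 ^ 2)%N -> (box n `<=` F)%fset ->
  normc (weierstrassE mu F (wp_nc mu F z) (wp_nc' mu F z)) <=
    4 * ((3 * (16 * C) ^+ 2 + 32 * (16 * C) + 35) * (8 * C)
         + (16 * C * 6 + 40) * box_bound) * recip R m.
Proof.
move=> nm nF.
have mn : (m <= n)%N by rewrite -ltnS nm -{1}[m.+1]expn1 leq_pexp2l.
have F0 : 0 \in F by move/fsubsetP: nF; apply; rewrite mem_box.
have sub_le f : (forall i, normc (f i) <= C * u i ^+ 3) ->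
    normc (\sum_(i <- F) f i - \sum_(i <- box n) f i) <= 8 * C * recip R m.
  move=> fC; apply: le_trans (sum_cubic_sub_le C_ge0 fC nF) _.
  by apply: ler_wpM2l (recip_le R mn); apply: mulr_ge0.
have sum_le f H := @sum_cubic_le _ C f H C_ge0.
have p3 i : normc ((z - v i) ^- 3) <= C * u i ^+ 3 by apply: pow_le.
have v4 i : normc (v i ^- 4) <= C * u i ^+ 3 by apply: pow_le.
have v6 i : normc (v i ^- 6) <= C * u i ^+ 3 by apply: pow_le.
rewrite weierstrassE_cubic // normcM normc_nat -mulrA ler_wpM2l // mulrDl.
have := weierstrass_cubic_lipschitz (sum_le _ F wp_le) (sum_le _ F p3)
  (sum_le _ (box n) wp_le) (sum_le _ (box n) p3) (sum_le _ (box n) v4)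
  (sub_le _ wp_le) (sub_le _ p3) (sub_le _ v4) (sub_le _ v6).
have := weierstrass_cubic_box nm.
rewrite -/(wp F) -/(P3 F) -/(G F 4) -/(G F 6) -/(wp (box n)) -/(P3 (box n)).
rewrite -/(G (box n) 4) -/(G (box n) 6) => box_le diff_le.
rewrite -[weierstrass_cubic _ _ _ _](subrK
  (weierstrass_cubic (wp (box n)) (P3 (box n)) (G (box n) 4) (G (box n) 6))).
by apply: normcD_le; rewrite -mulrA.
Qed.

End WeierstrassBound.

(** * Passage to cone ultrafilters *)

Theorem theorem3 (R : realType) (mu : R[i]) (hmu : mu \isn't Num.real)
    (z : R[i]) (hz : ~ lattice mu z)
    (u : set_system {fset int * int}) (hu : ConeUltraFilter u) :
  infinitesimal
    (net_class u (fun F => weierstrassE mu F (wp_nc mu F z) (wp_nc' mu F z))).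
Proof.
have [A A_ge1 /all_and2[v_bound zv_bound]] := recip_bounds z hmu.
have := weierstrassE_bound hmu hz A_ge1 v_bound zv_bound.
move: (4 * _) => c E_le r r_gt0.
rewrite /ultra_abs ultra_map_class; apply/ultra_lt_class.
(* The choice of [m] makes the bound smaller than [r], and [n + 1] is the square that the box
   estimate demands. *)
pose m := Num.bound `|c / r|; pose n := (m.+1 ^ 2).-1.
have nm : n.+1 = (m.+1 ^ 2)%N by rewrite prednK // expn_gt0.
have c_lt : c * recip R m < r.
  rewrite ltr_pdivrMr ?ltr0n // mulrC -ltr_pdivrMr //.
  apply: (@lt_trans _ _ m%:R); last by rewrite ltr_nat.
  exact: le_lt_trans (ler_norm _) (archi_boundP (normr_ge0 _)).
(* The bound holds for every [F] containing [box n], and these form a member of the ultrafilter. *)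
apply: filterS (cone_mem (box n)) => F nF.
exact: le_lt_trans (E_le n m F nm nF) c_lt.
Qed.
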